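(* Let $\{x_k\}$ be a sequence generated by the GIQN-CondG method (described in the context, with associated quantities $M_k$, $r_k$, $\tilde s_k$, $\alpha$). Assume that there are scalars $c_1>0$ and $c_2\ge 0$ such that, for every $k\ge 0$, the approximation $M_k$ of $F'(x_k)$ is invertible, $\|M_k^{-1}\|\le c_1$ and $\|r_k\|\le c_2\|F(x_k)\|$. Assume also that, for some constant $L$, $$\|F'(x)-F'(y)\|\le L\|x-y\|\quad\text{for all }x,y\in C.$$ If there is a constant $\delta$ with $0\le\delta<1-3\alpha$ such that, for all $k$ sufficiently large, the step $\tilde s_k$ satisfies $$\|F'(x_k)\tilde s_k+F(x_k)\|\le\delta\|F(x_k)\|,$$ then $\lim_{k\to\infty}\|F(x_k)\|=0$.
   Context: Setting: $\Omega\subset\mathbb{R}^n$ is open, $F:\Omega\to\mathbb{R}^n$ is continuously differentiable with Jacobian $F'(x)$, and $C\subset\Omega$ is a nonempty convex compact set. $\langle\cdot,\cdot\rangle$ and $\|\cdot\|$ are the Euclidean inner product and its associated norm (and the induced operator norm for matrices). CondG procedure. For $y\in\mathbb{R}^n$, $x\in C$, $\varepsilon\ge 0$, the output $z=\mathrm{CondG}(y,x,\varepsilon)$ is computed as follows. Set $z_1=x$, $t=1$. (P1) Compute an optimal solution $u_t$ of $g_t^*=\min_{u\in C}\langle z_t-y,u-z_t\rangle$. (P2) If $g_t^*\ge-\varepsilon$, set $z=z_t$ and stop; otherwise set $\alpha_t=\min\{1,-g_t^*/\|u_t-z_t\|^2\}$ and $z_{t+1}=z_t+\alpha_t(u_t-z_t)$.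 (P3) Replace $t$ by $t+1$ and go to (P1). GIQN-CondG method. Data: $x_0\in C$, $\alpha,\sigma\in(0,1)$, a positive sequence $\{\eta_k\}$ with $\sum_{k=0}^\infty\eta_k\le\eta<\infty$, and $\{\theta_j\}\subset[0,\infty)$. For $k=0,1,2,\dots$: (S.1) If $F(x_k)=0$, stop. (S.2) Choose an invertible approximation $M_k$ of $F'(x_k)$; for a residual $r_k\in\mathbb{R}^n$ compute $(s_k,y_k)$ with $M_ks_k=-F(x_k)+r_k$ and $y_k=x_k+s_k$. (S.3) If $y_k\in C$, set $\tilde s_k=s_k$; otherwise set $\tilde s_k=\mathrm{CondG}(y_k,x_k,\theta_k\|s_k\|^2)-x_k$. (S.4) Set $s_+=\tilde s_k$; set $s_-=-\tilde s_k$ if $\|\tilde s_k\|\ne0$ and $s_-=-s_k$ otherwise. For a trial step length $\lambda\in(0,1]$ and trial vector $\pi$ consider the conditions (A) $\|F(x_k+\pi)\|\le(1-\alpha(1+\lambda))\|F(x_k)\|$; (B) $\|F(x_k+\pi)\|\le(1+\eta_k-\alpha\lambda)\|F(x_k)\|$. Start with $\lambda=1$ and repeat the following: if $\pi=\lambda s_+$ satisfies (A), accept this $\pi$; else if $\pi=\lambda s_-$ satisfies $x_k+\pi\in C$ and (A), accept this $\pi$; else if $\|s_+\|\ne0$ and $\pi=\lambda s_+$ satisfies (B), accept this $\pi$; else if $\pi=\lambda s_-$ satisfies $x_k+\pi\in C$ and (B), accept this $\pi$; else replace $\lambda$ by $\sigma\lambda$ and repeat. (S.5) With $\lambda$ and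 $\pi$ the accepted step length and vector, set $\lambda_k=\lambda$, $p_k=\pi$, $x_{k+1}=x_k+p_k$. It is understood that each call to the CondG procedure terminates and that the method does not stop at (S.1), so that the generated sequences are infinite. *)

(* Defs.v *)
From mathcomp Require Import all_boot all_order all_algebra.
From mathcomp Require Import all_classical all_reals all_analysis.
Import Order.TTheory GRing.Theory Num.Theory.
Import numFieldNormedType.Exports.

Set Implicit Arguments.
Unset Strict Implicit.
Unset Printing Implicit Defensive.

Local Open Scope classical_set_scope.
Local Open Scope ring_scope.

(* Vectors of R^n are row vectors and matrices act on them from the right,
   following the convention of the library's [jacobian], for which
   [v *m 'J F x] is F'(x) v. Hence the textbook product A v is written
   [v *m A] throughout. *)

Definition edot {R : realType} {n : nat} (u v : 'rV[R]_n) : R :=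
  \sum_(i < n) u 0 i * v 0 i.

(* The library norm `|v| on matrices is the sup norm, so the Euclidean norm has
   to be introduced separately; the two induce the same topology. *)
Definition enorm {R : realType} {n : nat} (v : 'rV[R]_n) : R :=
  Num.sqrt (edot v v).

Definition opnorm {R : realType} {m n : nat} (A : 'M[R]_(m, n)) : R :=
  sup [set enorm (v *m A) | v in [set v : 'rV[R]_m | enorm v <= 1]].

Definition C1_on {R : realType} {n : nat} (Omega : set 'rV[R]_n)
    (F : 'rV[R]_n -> 'rV[R]_n) : Prop :=
  forall x, Omega x ->
    differentiable F x /\ {for x, continuous (fun z => jacobian F z)}.

Section CondG.
Context {R : realType} {n : nat}.
Variables (C : set 'rV[R]_n) (y : 'rV[R]_n) (eps : R).

Definition linear_minimizer (z u : 'rV[R]_n) : Prop :=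
  C u /\ forall v, C v -> edot (z - y) (u - z) <= edot (z - y) (v - z).

(* [CondG z w]: the procedure, run from the current iterate z, terminates and
   may output w. It is a relation rather than a function because the minimizer
   u is not unique. *)
Inductive CondG : 'rV[R]_n -> 'rV[R]_n -> Prop :=
| CondG_stop z u :
    linear_minimizer z u ->
    - eps <= edot (z - y) (u - z) ->
    CondG z z
| CondG_step z u w :
    linear_minimizer z u ->
    edot (z - y) (u - z) < - eps ->
    CondG (z + Num.min 1 (- edot (z - y) (u - z) / enorm (u - z) ^+ 2)
                 *: (u - z)) w ->
    CondG z w.

End CondG.

Section LineSearch.
Context {R : realType} {n : nat}.
Variables (C : set 'rV[R]_n) (F : 'rV[R]_n -> 'rV[R]_n).
Variables (alpha sigma eta : R) (x sp sm : 'rV[R]_n).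

Definition condA (lam : R) (p : 'rV[R]_n) : bool :=
  enorm (F (x + p)) <= (1 - alpha * (1 + lam)) * enorm (F x).

Definition condB (lam : R) (p : 'rV[R]_n) : bool :=
  enorm (F (x + p)) <= (1 + eta - alpha * lam) * enorm (F x).

Definition trial (lam : R) : option 'rV[R]_n :=
  if condA lam (lam *: sp) then Some (lam *: sp)
  else if (x + lam *: sm \in C) && condA lam (lam *: sm) then Some (lam *: sm)
  else if (enorm sp != 0) && condB lam (lam *: sp) then Some (lam *: sp)
  else if (x + lam *: sm \in C) && condB lam (lam *: sm) then Some (lam *: sm)
  else None.

(* [line_search lam lam' p]: backtracking started at the trial step length lam
   terminates, accepting the step length lam' and the vector p. *)
Inductive line_search : R -> R -> 'rV[R]_n -> Prop :=
| line_search_accept lam p :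
    trial lam = Some p -> line_search lam lam p
| line_search_backtrack lam lam' p :
    trial lam = None ->
    line_search (sigma * lam) lam' p ->
    line_search lam lam' p.

End LineSearch.

(* A complete infinite run of the GIQN-CondG method. [st k] is the feasible step
   (s with a tilde). That M k approximates F'(x k) carries no formal
   requirement beyond invertibility. *)
Record GIQN_CondG {R : realType} {n : nat} (C : set 'rV[R]_n)
    (F : 'rV[R]_n -> 'rV[R]_n) (x0 : 'rV[R]_n) (alpha sigma : R)
    (eta_ theta : nat -> R) (x : nat -> 'rV[R]_n) (M : nat -> 'M[R]_n)
    (r s y st : nat -> 'rV[R]_n) (lam : nat -> R) (p : nat -> 'rV[R]_n) :
    Prop := {
  GIQN_init : x 0%N = x0;
  GIQN_nonstop : forall k, F (x k) != 0;
  GIQN_unit : forall k, M k \in unitmx;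
  GIQN_step : forall k, s k *m M k = - F (x k) + r k;
  GIQN_y : forall k, y k = x k + s k;
  GIQN_feasible : forall k, C (y k) -> st k = s k;
  GIQN_CondG_step : forall k, ~ C (y k) ->
    exists2 z, CondG C (y k) (theta k * enorm (s k) ^+ 2) (x k) z
             & st k = z - x k;
  GIQN_search : forall k,
    line_search C F alpha sigma (eta_ k) (x k)
      (st k) (if enorm (st k) != 0 then - st k else - s k)
      1 (lam k) (p k);
  GIQN_next : forall k, x k.+1 = x k + p k
}.

(* Main.v *)
Require Import Defs.
From mathcomp Require Import all_boot all_order all_algebra.
From mathcomp Require Import all_classical all_reals all_analysis.
From mathcomp Require Import ring lra.
Import Order.TTheory GRing.Theory Num.Theory.
Import numFieldNormedType.Exports.

Set Implicit Arguments.
Unset Strict Implicit.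
Unset Printing Implicit Defensive.

Local Open Scope classical_set_scope.
Local Open Scope ring_scope.

(** Write f_k for the Euclidean norm of F(x_k). The iterates stay in C: the
    step accepted by the line search is either a fraction of the feasible step,
    hence lands in the convex set C, or is tested for membership in C; and the
    feasible step itself leads to a point of C, namely y_k when it lies there,
    and otherwise the output of the conditional gradient procedure, which only
    moves along segments of C.

    Condition (A) implies (B), so every accepted step satisfies
      f_(k+1) <= (1 + eta_k - alpha lambda_k) f_k.
    As eta is summable, f is bounded, and summing the inequalities shows that
    the series of lambda_k f_k converges; in particular lambda_k f_k tends to 0
    ([perturbed_descent_bounded], [perturbed_descent_cvg0]).

    It remains to see that lambda_k is eventually at least a fixed multiple of
    f_k, for then f_k ^ 2 tends to 0 ([cvg0_of_weighted_cvg0]). If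
    lambda_k = 1, boundedness of f suffices. Otherwise the step length
    nu = lambda_k / sigma was rejected, so (B) failed at nu times the feasible
    step. Expanding F to first order along that step, the inexact Newton
    condition yields a decrease by the factor 1 - nu (1 - delta), up to an error
    of order nu ^ 2 times the squared length of the step, which is at most the
    squared diameter of C. The failure of (B) therefore forces f_k = O(nu)
    ([rejected_step_bound]), where 1 - delta - alpha > 0 is what makes the
    estimate conclusive.

    The first-order expansion [first_order_error] comes from the scalar mean
    value theorem applied to the error paired with its own value at the end of
    the step, which gives the bound directly in the Euclidean norm. *)

(** * The Euclidean norm and the operator norm *)

Section Euclid.
Context {R : realType} {n : nat}.
Implicit Types (u v w : 'rV[R]_n) (a b : R).

Lemma edotC u v : edot u v = edot v u.
Proof. by apply: eq_bigr => i _; rewrite mulrC. Qed.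

Lemma edotDl u v w : edot (u + v) w = edot u w + edot v w.
Proof. by rewrite -big_split; apply: eq_bigr => i _; rewrite mxE mulrDl. Qed.

Lemma edotZl a u v : edot (a *: u) v = a * edot u v.
Proof. by rewrite mulr_sumr; apply: eq_bigr => i _; rewrite mxE mulrA. Qed.

Lemma edotNl u v : edot (- u) v = - edot u v.
Proof. by rewrite -scaleN1r edotZl mulN1r. Qed.

Lemma edotDr u v w : edot w (u + v) = edot w u + edot w v.
Proof. by rewrite edotC edotDl !(edotC w). Qed.

Lemma edotZr a u v : edot u (a *: v) = a * edot u v.
Proof. by rewrite edotC edotZl edotC. Qed.

Lemma edotNr u v : edot u (- v) = - edot u v.
Proof. by rewrite edotC edotNl edotC. Qed.

Lemma edot_ge0 v : 0 <= edot v v.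
Proof. by apply: sumr_ge0 => i _; rewrite -expr2 sqr_ge0. Qed.

Lemma enorm_ge0 v : 0 <= enorm v.
Proof. exact: sqrtr_ge0. Qed.

Lemma sqr_enorm v : enorm v ^+ 2 = edot v v.
Proof. by rewrite sqr_sqrtr ?edot_ge0. Qed.

Lemma enorm_eq0 v : (enorm v == 0) = (v == 0).
Proof.
rewrite -sqrf_eq0 sqr_enorm psumr_eq0; last by move=> i _; rewrite -expr2 sqr_ge0.
apply/allP/eqP => [v0|-> i _]; last by rewrite /= mxE mulr0 eqxx.
apply/rowP => i; rewrite mxE; apply/eqP.
by have := v0 i (mem_index_enum i); rewrite mulf_eq0 orbb.
Qed.

Lemma enorm_gt0 v : (0 < enorm v) = (v != 0).
Proof. by rewrite lt0r enorm_ge0 andbT enorm_eq0. Qed.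

Lemma enorm0 : enorm (0 : 'rV[R]_n) = 0.
Proof. by apply/eqP; rewrite enorm_eq0. Qed.

Lemma enormZ a v : enorm (a *: v) = `|a| * enorm v.
Proof.
by rewrite /enorm edotZl edotZr mulrA -expr2 sqrtrM ?sqr_ge0// sqrtr_sqr.
Qed.

(** Cauchy-Schwarz, from the nonnegativity of the square of
    [enorm v *: u - enorm u *: v]. *)
Lemma edot_le_enorm u v : edot u v <= enorm u * enorm v.
Proof.
have [->|u0] := eqVneq u 0.
  by rewrite enorm0 mul0r -(scale0r 0) edotZl mul0r lexx.
have [->|v0] := eqVneq v 0.
  by rewrite enorm0 mulr0 -(scale0r 0) edotZr mul0r lexx.
have uv0 : 0 < enorm u * enorm v by rewrite mulr_gt0 ?enorm_gt0.
have := edot_ge0 (enorm v *: u - enorm u *: v).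
rewrite edotDl !edotDr !(edotNl, edotNr, edotZl, edotZr) (edotC v u) -!sqr_enorm.
move=> h; rewrite -subr_ge0 -(pmulr_rge0 _ uv0); nra.
Qed.

Lemma ler_enormD u v : enorm (u + v) <= enorm u + enorm v.
Proof.
rewrite -(ler_pXn2r (n := 2)) ?nnegrE ?addr_ge0 ?enorm_ge0//.
rewrite sqrrD !sqr_enorm edotDl !edotDr (edotC v u).
have := edot_le_enorm u v; lra.
Qed.

(** [`|v|] is the sup norm; the comparison turns boundedness of a compact set
    into a bound on Euclidean distances. *)
Lemma sqr_enorm_le_norm v : enorm v ^+ 2 <= n%:R * `|v| ^+ 2.
Proof.
rewrite sqr_enorm.
have h i : `|v 0 i| <= `|v|.
  by rewrite [leRHS]/Num.Def.normr/= mx_normrE; apply/bigmax_geP; right; exists (0, i).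
rewrite mulr_natl -[X in _ *+ X]card_ord -sumr_const; apply: ler_sum => i _.
by rewrite -expr2 -real_normK ?num_real// ler_pXn2r ?nnegrE.
Qed.

End Euclid.

(** The supremum defining [opnorm] is only meaningful once the set is known to
    be bounded; applying Cauchy-Schwarz to each column bounds it by the
    Frobenius norm. The inequality then follows by normalizing [v]. *)
Lemma enorm_mul_le_opnorm (R : realType) (m n : nat) (A : 'M[R]_(m, n)) (v : 'rV[R]_m) :
  enorm (v *m A) <= opnorm A * enorm v.
Proof.
pose c : 'I_n -> 'rV[R]_m := fun j => (col j A)^T.
have ub : has_ubound [set enorm (v *m A) | v in [set v : 'rV[R]_m | enorm v <= 1]].
  exists (Num.sqrt (\sum_j enorm (c j) ^+ 2)) => _ [w /= w1 <-].
  apply: ler_wsqrtr; apply: ler_sum => j _.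
  have -> : (w *m A) 0 j = edot w (c j).
    by rewrite mxE; apply: eq_bigr => i _; rewrite !mxE.
  rewrite -expr2 -real_normK ?num_real// ler_pXn2r ?nnegrE ?enorm_ge0//.
  have wc : enorm w * enorm (c j) <= enorm (c j) by rewrite ler_piMl ?enorm_ge0.
  rewrite ler_norml (le_trans (edot_le_enorm _ _) wc) andbT lerNl -edotNl.
  by rewrite (le_trans (edot_le_enorm _ _))// -scaleN1r enormZ normrN1 mul1r.
have [->|v0] := eqVneq v 0; first by rewrite mul0mx !enorm0 mulr0.
have v1 : 0 < enorm v by rewrite enorm_gt0.
rewrite -ler_pdivrMr// mulrC -[_^-1]ger0_norm ?invr_ge0 ?enorm_ge0//.
rewrite -enormZ scalemxAl; apply: ub_le_sup => //.
exists ((enorm v)^-1 *: v) => //=.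
by rewrite enormZ ger0_norm ?invr_ge0 ?enorm_ge0// mulVf ?gt_eqF.
Qed.

Section ConvexCompact.
Context {R : realType} {n : nat}.

Lemma convex_segment (C : set 'rV[R]_n) (u v : 'rV[R]_n) (t : R) :
  convex_set C -> C u -> C v -> 0 <= t <= 1 -> C (u + t *: (v - u)).
Proof.
move=> Cc Cu Cv t01.
have t01' : Itv.spec (@Itv.num_sem R) (Itv.Real `[0%Z, 1%Z]) t.
  by rewrite /Itv.num_sem/= num_real/= in_itv/=.
have := Cc v u (Itv.mk t01'); rewrite !inE => /(_ Cv Cu).
rewrite /conv/= => h.
by rewrite scalerBr addrCA -[X in X - _]scale1r -scalerBl.
Qed.

(** The squared diameter is what the error term of a first-order expansion
    involves. *)
Lemma compact_enorm_bounded (C : set 'rV[R]_n) : compact C ->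
  exists2 D, 0 <= D & forall u v, C u -> C v -> enorm (u - v) ^+ 2 <= D.
Proof.
move=> /compact_bounded[B [_ hB]].
exists (n%:R * ((B + 1) + (B + 1)) ^+ 2); first by rewrite mulr_ge0 ?sqr_ge0.
move=> u v Cu Cv; apply: le_trans (sqr_enorm_le_norm _) _.
have b w : C w -> `|w| <= B + 1 by apply: hB; rewrite ltrDl.
have uv : `|u - v| <= B + 1 + (B + 1) by rewrite (le_trans (ler_normB _ _))// lerD// b.
by rewrite ler_wpM2l// ler_pXn2r ?nnegrE// (le_trans _ uv).
Qed.

End ConvexCompact.

(** * First-order expansion along a segment *)

Section Calculus.
Context {R : realType} {n : nat}.

Lemma is_derive_segment (F : 'rV[R]_n -> 'rV[R]_n) (x h : 'rV[R]_n) (t : R) :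
  differentiable F (x + t *: h) ->
  is_derive t 1 (fun t => F (x + t *: h)) (h *m jacobian F (x + t *: h)).
Proof.
(* The difference quotients are those of F in the direction h. *)
move=> dF; have quotE :
    (fun e => e^-1 *: (((fun t => F (x + t *: h)) \o shift t) (e *: 1) - F (x + t *: h)))
  = (fun e => e^-1 *: ((F \o shift (x + t *: h)) (e *: h) - F (x + t *: h))).
  apply/funext => e; congr (_ *: (F _ - _)).
  by rewrite /= scaler1 scalerDl addrCA.
apply: DeriveDef.
  by rewrite /derivable quotE; have := @diff_derivable _ _ _ F (x + t *: h) h dF.
by rewrite /derive quotE -deriveEjacobian.
Qed.

Lemma is_derive_edotl (G : R -> 'rV[R]_n) (dG w : 'rV[R]_n) (t : R) :
  is_derive t 1 G dG -> is_derive t 1 (fun t => edot (G t) w) (edot dG w).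
Proof.
move=> GdG.
have Gd : derivable G t 1 by exact: ex_derive.
have coordD i : is_derive t 1 (fun t => w 0 i *: G t 0 i : R) (w 0 i *: dG 0 i).
  apply: is_deriveZ; apply: DeriveDef; first exact: (derivable_mxP _ _ _).1.
  by rewrite -(@derive_val _ _ _ _ _ _ _ GdG) (derive_mx Gd) mxE.
have := is_derive_sum coordD.
have -> : \sum_(i < n) (fun t => w 0 i *: G t 0 i : R) = fun t => edot (G t) w.
  apply/funext => s; rewrite fct_sumE; apply: eq_bigr => i _; exact: mulrC.
congr is_derive; apply: eq_bigr => i _; exact: mulrC.
Qed.

Lemma is_derive_scalel (v : 'rV[R]_n) (t : R) : is_derive t 1 (fun t => t *: v) v.
Proof.
have dv : is_diff t ( *:%R ^~ v) ( *:%R ^~ v) by exact: is_diff_scalel.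
have dv' : differentiable (fun t : R => t *: v) t by exact: ex_diff.
apply: DeriveDef; first exact: diff_derivable.
by rewrite deriveE// diff_val scale1r.
Qed.

(** Let [w] be the error. The function
    t |-> < F (x + t h) - t F'(x) h, w > varies by |w|^2 between 0 and 1, while
    its derivative is < (F'(x + t h) - F'(x)) h, w >, of size at most
    |L| |h|^2 |w|. The mean value theorem costs a factor 2 over the integral
    form of the remainder, which is harmless here. *)
Lemma first_order_error (F : 'rV[R]_n -> 'rV[R]_n) (x h : 'rV[R]_n) (L : R) :
  (forall t : R, 0 <= t <= 1 -> differentiable F (x + t *: h)) ->
  (forall t : R, 0 <= t <= 1 ->
    opnorm (jacobian F (x + t *: h) - jacobian F x) <= L * enorm (t *: h)) ->
  enorm (F (x + h) - F x - h *m jacobian F x) <= `|L| * enorm h ^+ 2.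
Proof.
move=> dF lipF; set w := _ - _ - _.
pose g t := edot (F (x + t *: h) - t *: (h *m jacobian F x)) w.
have dg (t : R) : 0 <= t <= 1 -> is_derive t 1 g
    (edot (h *m (jacobian F (x + t *: h) - jacobian F x)) w).
  move=> t01; apply: is_derive_edotl; rewrite mulmxBr.
  apply: is_deriveB; first exact/is_derive_segment/dF.
  exact: is_derive_scalel.
pose dgf (t : R) := edot (h *m (jacobian F (x + t *: h) - jacobian F x)) w.
have [||t] := @MVT _ g dgf 0 1 ltr01.
- by move=> t /=; rewrite in_itv/= => /andP[t0 t1]; apply: dg; rewrite !ltW.
- apply: derivable_within_continuous => t; rewrite in_itv/= => t01.
  by have := dg _ t01 => -[].
rewrite in_itv/= => /andP[t0 t1].
have t01 : 0 <= t <= 1 by rewrite !ltW.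
rewrite subr0 mulr1 /g /dgf -edotNl -edotDl !scale1r !scale0r addr0 subr0.
rewrite addrAC -/w -sqr_enorm => wE.
have [->|w0] := eqVneq w 0; first by rewrite enorm0 mulr_ge0 ?sqr_ge0.
have w_gt0 : 0 < enorm w by rewrite enorm_gt0.
rewrite -(ler_pM2r w_gt0) -[leLHS]expr2 wE.
apply: le_trans (edot_le_enorm _ _) _; rewrite ler_wpM2r ?enorm_ge0//.
apply: le_trans (enorm_mul_le_opnorm _ _) _.
rewrite expr2 mulrA ler_wpM2r ?enorm_ge0//; apply: le_trans (lipF _ t01) _.
rewrite enormZ (ger0_norm (ltW t0)).
apply: (@le_trans _ _ (`|L| * (t * enorm h))).
  by rewrite ler_wpM2r ?ler_norm// mulr_ge0 ?enorm_ge0 ?ltW.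
by rewrite ler_wpM2l// ler_piMl ?enorm_ge0 ?ltW.
Qed.

End Calculus.

(** * Descent up to a summable perturbation *)

Section Descent.
Context {R : realType}.
Variables (f e l : nat -> R) (a S : R).
Hypotheses (a_gt0 : 0 < a) (f_ge0 : forall k, 0 <= f k)
  (e_ge0 : forall k, 0 <= e k) (l_ge0 : forall k, 0 <= l k)
  (e_sum : forall m, \sum_(0 <= k < m) e k <= S)
  (f_next : forall k, f k.+1 <= (1 + e k - a * l k) * f k).

(** Each step multiplies [f] by at most 1 + e k <= exp (e k). *)
Lemma perturbed_descent_bounded k : f k <= f 0%N * expR S.
Proof.
suff h : f k <= f 0%N * expR (\sum_(0 <= i < k) e i).
  by apply: le_trans h _; rewrite ler_wpM2l// ler_expR.
elim: k => [|k ih]; first by rewrite big_geq// expR0 mulr1.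
rewrite big_nat_recr//= expRD; apply: le_trans (f_next k) _.
rewrite mulrA [leRHS]mulrC; apply: le_trans (_ : expR (e k) * f k <= _).
  rewrite ler_wpM2r//; apply: le_trans (expR_ge1Dx _).
  by rewrite gerBl mulr_ge0// ltW.
by rewrite ler_wpM2l// expR_ge0.
Qed.

(** Telescoping [a * (l k * f k) <= f k - f k.+1 + e k * B], where [B] bounds
    [f], bounds the partial sums of the nonnegative series of general term
    [l k * f k]. *)
Lemma perturbed_descent_cvg0 : l k * f k @[k --> \oo] --> (0 : R).
Proof.
set B := f 0%N * expR S.
have le1 k : \sum_(0 <= i < k) a * (l i * f i) + f k <= f 0%N + \sum_(0 <= i < k) e i * B.
  elim: k => [|k ih]; first by rewrite !big_geq// add0r addr0.
  rewrite !big_nat_recr//=.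
  have : e k * f k <= e k * B by rewrite ler_wpM2l// perturbed_descent_bounded.
  have := f_next k; lra.
have term_ge0 k : 0 <= l k * f k by rewrite mulr_ge0.
have B_ge0 : 0 <= B by rewrite mulr_ge0// expR_ge0.
apply: cvg_series_cvg_0; apply: nondecreasing_is_cvgn.
  by apply/nondecreasing_seqP => k; rewrite seriesSr lerDl.
exists (a^-1 * (f 0%N + S * B)) => _ [k _ <-].
rewrite ler_pdivlMl// /series/= mulr_sumr.
have := le1 k; rewrite -mulr_suml.
have : (\sum_(0 <= i < k) e i) * B <= S * B by rewrite ler_wpM2r.
have := f_ge0 k; lra.
Qed.

End Descent.

Lemma nonneg_series_partial_sum_le (R : realType) (e : nat -> R) (S : R) :
  (forall k, 0 <= e k) -> (\sum_(0 <= k <oo) (e k)%:E <= S%:E)%E ->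
  forall m, \sum_(0 <= k < m) e k <= S.
Proof.
move=> e0 eS m; rewrite -lee_fin; apply: le_trans eS.
by rewrite -sumEFin; apply: nneseries_lim_ge => k _ _; rewrite lee_fin.
Qed.

(** The hypotheses give [c * f k ^+ 2 <= l k * f k], hence f^2 --> 0. *)
Lemma cvg0_of_weighted_cvg0 (R : realType) (f l : nat -> R) (c : R) :
  0 < c -> (forall k, 0 <= f k) -> (\forall k \near \oo, c * f k <= l k) ->
  l k * f k @[k --> \oo] --> (0 : R) -> f k @[k --> \oo] --> (0 : R).
Proof.
move=> c0 f0 cfl lf0; apply/cvgr0Pnorm_lt => e e0.
have ce : 0 < c * e ^+ 2 by rewrite mulr_gt0// exprn_gt0.
near=> k.
rewrite ger0_norm// -(ltr_pXn2r (n := 2)) ?nnegrE//; last exact: ltW.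
rewrite -(ltr_pM2l c0); apply: le_lt_trans (_ : l k * f k < _).
  by rewrite expr2 mulrA ler_wpM2r//; near: k.
apply: le_lt_trans (ler_norm _) _.
by near: k; move: lf0 => /cvgr0Pnorm_lt; apply.
Unshelve. all: by end_near. Qed.

(** * The feasible step and the line search *)

(** The step length min(1, - g / |u - z|^2) lies in [0, 1] because the step is
    only taken when g < - eps <= 0, so each iterate lies on a segment of [C]. *)
Lemma CondG_feasible (R : realType) (n : nat) (C : set 'rV[R]_n) y eps z w :
  convex_set C -> 0 <= eps -> CondG C y eps z w -> C z -> C w.
Proof.
move=> Cc eps0; elim=> // {}z u {}w [Cu _] lt _ ih Cz; apply: ih.
apply: convex_segment => //.
rewrite le_min ler01 ge_min lexx andbT/=; rewrite divr_ge0 ?sqr_ge0//.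
by rewrite oppr_ge0 (le_trans (ltW lt))// oppr_le0.
Qed.

Section LineSearchFacts.
Context {R : realType} {n : nat}.
Variables (C : set 'rV[R]_n) (F : 'rV[R]_n -> 'rV[R]_n).
Variables (alpha sigma eta : R) (x sp sm : 'rV[R]_n).
Hypotheses (alpha_ge0 : 0 <= alpha) (eta_ge0 : 0 <= eta).
Hypotheses (sigma01 : 0 < sigma < 1).

Lemma condA_condB lam p :
  condA F alpha x lam p -> condB F alpha eta x lam p.
Proof.
rewrite /condA /condB => /le_trans; apply; rewrite ler_wpM2r ?enorm_ge0//.
have := alpha_ge0; have := eta_ge0; lra.
Qed.

(** In the two cases where the trial follows [sm], membership in [C] is part of
    the test; in the other two it comes from convexity. *)
Lemma trial_accepted lam p : convex_set C -> C x -> C (x + sp) ->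
  0 <= lam <= 1 -> trial C F alpha eta x sp sm lam = Some p ->
  C (x + p) /\ condB F alpha eta x lam p.
Proof.
move=> Cc Cx Csp lam01.
have Cl : C (x + lam *: sp).
  have spE : x + sp - x = sp by rewrite addrC addKr.
  by have := convex_segment Cc Cx Csp lam01; rewrite spE.
rewrite /trial; case: ifPn => [A [<-]|_]; first by split=> //; exact: condA_condB.
case: ifPn => [/andP[/set_mem Cm A] [<-]|_].
  by split=> //; exact: condA_condB.
case: ifPn => [/andP[_ B] [<-]//|_].
by case: ifPn => // /andP[/set_mem Cm B] [<-].
Qed.

Lemma trial_rejected lam : enorm sp != 0 ->
  trial C F alpha eta x sp sm lam = None ->
  (1 + eta - alpha * lam) * enorm (F x) < enorm (F (x + lam *: sp)).
Proof.
move=> sp0; rewrite /trial sp0; do 2 case: ifP => // _; case: ifPn => //=.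
by rewrite /condB -ltNge.
Qed.

(** When the accepted step length is not the initial one, the search must have
    rejected the length just before it; the convergence proof reads its lower
    bound on the step length off that rejection. *)
Lemma line_search_spec mu lam p : 0 < mu <= 1 ->
  line_search C F alpha sigma eta x sp sm mu lam p ->
  [/\ 0 < lam <= 1, trial C F alpha eta x sp sm lam = Some p
    & lam = mu \/ exists nu, [/\ 0 < nu <= 1, lam = sigma * nu
        & trial C F alpha eta x sp sm nu = None]].
Proof.
move=> + ls; elim: ls => {mu lam p} [mu p acc mu01|mu lam p rej _ ih mu01].
  by split=> //; left.
have /andP[mu0 mu1] := mu01; have /andP[s0 s1] := sigma01.
have [|lam01 acc prev] := ih; first by rewrite mulr_gt0//= mulr_ile1// ltW.
by split=> //; right; case: prev => // ->; exists mu.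
Qed.

End LineSearchFacts.

(** * Convergence of the residuals *)

(** The expansion at step length [nu] reads
      F (x + nu h) = err + (1 - nu) F x + nu (F'(x) h + F x)
    with |err| <= |L| nu^2 D. Its norm is at most
    (1 - nu (1 - delta)) |F x| + |L| D nu^2, whereas rejection makes it larger
    than (1 - alpha nu) |F x|; dividing by [nu] gives the bound. *)
Lemma rejected_step_bound (R : realType) (n : nat) (C : set 'rV[R]_n)
    (F : 'rV[R]_n -> 'rV[R]_n) (x h : 'rV[R]_n) (L delta alpha eta nu D : R) :
  convex_set C -> (forall z, C z -> differentiable F z) ->
  (forall u v, C u -> C v ->
    opnorm (jacobian F u - jacobian F v) <= L * enorm (u - v)) ->
  C x -> C (x + h) -> enorm h ^+ 2 <= D ->
  enorm (h *m jacobian F x + F x) <= delta * enorm (F x) ->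
  0 <= eta -> 0 < nu <= 1 ->
  (1 + eta - alpha * nu) * enorm (F x) < enorm (F (x + nu *: h)) ->
  (1 - delta - alpha) * enorm (F x) <= `|L| * D * nu.
Proof.
move=> Cc dF lipF Cx Cxh hD inexact eta0 /andP[nu0 nu1] rej.
have Cseg (t : R) : 0 <= t <= 1 -> C (x + t *: (nu *: h)).
  move=> /andP[t0 t1]; rewrite scalerA.
  have := convex_segment Cc Cx Cxh (t := t * nu).
  by rewrite addrAC subrr add0r; apply; rewrite mulr_ge0 ?mulr_ile1// ltW.
have := @first_order_error _ _ F x (nu *: h) L.
set err := _ - _ - _ => errP.
have {}errP : enorm err <= `|L| * (nu ^+ 2 * D).
  have h1 : enorm (nu *: h) ^+ 2 <= nu ^+ 2 * D.
    by rewrite enormZ exprMn (ger0_norm (ltW nu0)) ler_wpM2l ?sqr_ge0.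
  apply: le_trans (errP _ _) _.
  - by move=> t /Cseg/dF.
  - by move=> t /Cseg Ct; rewrite -[X in enorm X](addKr x) [X in enorm X]addrC; exact: lipF.
  - by rewrite ler_wpM2l.
set lin := h *m jacobian F x + F x in inexact.
have split_F : F (x + nu *: h) = err + ((1 - nu) *: F x + nu *: lin).
  rewrite /err /lin -scalemxAl scalerDr scalerBl scale1r.
  by rewrite [nu *: _ + nu *: _]addrC subrKA [F x + _]addrC subrKA subrK.
have := ler_enormD err ((1 - nu) *: F x + nu *: lin).
have := ler_enormD ((1 - nu) *: F x) (nu *: lin).
rewrite -split_F !enormZ (ger0_norm (ltW nu0)) ger0_norm ?subr_ge0// => h1 h2.
have h3 : nu * enorm lin <= nu * (delta * enorm (F x)) by rewrite ler_wpM2l// ltW.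
have h4 : 0 <= eta * enorm (F x) by rewrite mulr_ge0// enorm_ge0.
rewrite -(ler_pM2l nu0); lra.
Qed.

Theorem theorem5 (R : realType) (n : nat)
    (Omega C : set 'rV[R]_n) (F : 'rV[R]_n -> 'rV[R]_n)
    (HOmega : open Omega) (HF : C1_on Omega F)
    (HCOmega : C `<=` Omega) (HC0 : C !=set0)
    (HCconvex : convex_set C) (HCcompact : compact C)
    (x0 : 'rV[R]_n) (Hx0 : C x0)
    (alpha sigma : R) (Halpha : 0 < alpha < 1) (Hsigma : 0 < sigma < 1)
    (eta_ : nat -> R) (eta : R) (Heta_pos : forall k, 0 < eta_ k)
    (Heta_sum : (\sum_(0 <= k <oo) (eta_ k)%:E <= eta%:E)%E)
    (theta : nat -> R) (Htheta : forall j, 0 <= theta j)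
    (x : nat -> 'rV[R]_n) (M : nat -> 'M[R]_n)
    (r s y st : nat -> 'rV[R]_n) (lam : nat -> R) (p : nat -> 'rV[R]_n)
    (Hrun : GIQN_CondG C F x0 alpha sigma eta_ theta x M r s y st lam p)
    (c1 c2 : R) (Hc1 : 0 < c1) (Hc2 : 0 <= c2)
    (HM : forall k : nat, [/\ M k \in unitmx, opnorm (invmx (M k)) <= c1
                            & enorm (r k) <= c2 * enorm (F (x k))])
    (L : R)
    (HL : forall u v, C u -> C v ->
       opnorm (jacobian F u - jacobian F v) <= L * enorm (u - v))
    (delta : R) (Hdelta : 0 <= delta < 1 - 3 * alpha)
    (Hst : \forall k \near \oo,
       enorm (st k *m jacobian F (x k) + F (x k)) <= delta * enorm (F (x k))) :
  enorm (F (x k)) @[k --> \oo] --> (0 : R).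
Proof.
have [a0 a1] := andP Halpha; have [s0 s1] := andP Hsigma.
have [d0 d1] := andP Hdelta.
have eta_ge0 k : 0 <= eta_ k by exact: ltW.
have [D D0 CD] := compact_enorm_bounded HCcompact.
have Cst k : C (x k) -> C (x k + st k).
  move=> Cx; have [Cy|nCy] := pselect (C (y k)).
    by rewrite (GIQN_feasible Hrun Cy) -(GIQN_y Hrun).
  have [z zC ->] := GIQN_CondG_step Hrun nCy.
  rewrite addrC subrK; apply: (CondG_feasible _ _ zC) => //.
  by rewrite mulr_ge0// sqr_ge0.
have one01 : 0 < (1 : R) <= 1 by rewrite ltr01 lexx.
have acc k : C (x k) -> C (x k.+1) /\ condB F alpha (eta_ k) (x k) (lam k) (p k).
  move=> Cx; have := GIQN_search Hrun k.
  move=> /(line_search_spec Hsigma one01)[/andP[l0 l1] + _].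
  rewrite (GIQN_next Hrun); apply: trial_accepted => //; [exact: ltW|exact: Cst|].
  by rewrite l1 ltW.
have Cx k : C (x k).
  by elim: k => [|k /acc[]//]; rewrite (GIQN_init Hrun).
pose f k := enorm (F (x k)).
have f_gt0 k : 0 < f k by rewrite enorm_gt0 (GIQN_nonstop Hrun).
have lam01 k : 0 < lam k <= 1.
  by have [] := line_search_spec Hsigma one01 (GIQN_search Hrun k).
have lam_ge0 k : 0 <= lam k by have /andP[/ltW] := lam01 k.
have f_next k : f k.+1 <= (1 + eta_ k - alpha * lam k) * f k.
  by rewrite /f (GIQN_next Hrun); exact: (acc k (Cx k)).2.
have e_sum := nonneg_series_partial_sum_le eta_ge0 Heta_sum.
have f_ge0 k : 0 <= f k by exact: ltW.
have fB := perturbed_descent_bounded a0 f_ge0 lam_ge0 e_sum f_next.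
have lamf0 := perturbed_descent_cvg0 a0 f_ge0 eta_ge0 lam_ge0 e_sum f_next.
set B := f 0%N * expR eta in fB.
have B_gt0 : 0 < B by rewrite mulr_gt0// expR_gt0.
pose g := 1 - delta - alpha.
have g_gt0 : 0 < g by rewrite /g; lra.
(* The summand 1 keeps K positive when L or the diameter of C vanishes. *)
pose K := `|L| * D / sigma + 1.
have K_gt0 : 0 < K by rewrite ltr_wpDl// divr_ge0 ?mulr_ge0// ltW.
pose c := Num.min (g / K) B^-1.
have c_gt0 : 0 < c by rewrite lt_min divr_gt0//= invr_gt0.
have lam_lb : \forall k \near \oo, c * f k <= lam k.
  near=> k.
  have st_descent : enorm (st k *m jacobian F (x k) + F (x k)) <= delta * f k.
    by near: k; exact: Hst.
  have st0 : enorm (st k) != 0.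
    (* A null step would turn the inexact Newton condition into
       f k <= delta * f k with delta < 1. *)
    apply/eqP => /eqP; rewrite enorm_eq0 => /eqP st0.
    move: st_descent; rewrite st0 mul0mx add0r -/(f k).
    have := f_gt0 k; nra.
  have [_ _ [->|[nu [nu01 -> rej]]]] :=
      line_search_spec Hsigma one01 (GIQN_search Hrun k).
    apply: le_trans (_ : B^-1 * B <= _); last by rewrite mulVf ?gt_eqF.
    apply: ler_pM => //; first exact: ltW.
    by rewrite ge_min lexx orbT.
  have hD : enorm (st k) ^+ 2 <= D.
    by have := CD _ _ (Cst k (Cx k)) (Cx k); rewrite addrAC subrr add0r.
  have dF z : C z -> differentiable F z by move=> /HCOmega/HF[].
  have bound := rejected_step_bound HCconvex dF HL (Cx k) (Cst k (Cx k)) hD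
    st_descent (eta_ge0 k) nu01 (trial_rejected st0 rej).
  apply: le_trans (_ : g / K * f k <= _).
    by rewrite ler_wpM2r// ge_min lexx.
  rewrite mulrAC ler_pdivrMr//; apply: le_trans bound _.
  rewrite /K mulrDr mulr1 [sigma * nu * _]mulrC mulrA divfK ?gt_eqF//.
  by rewrite lerDl mulr_ge0// ltW//; have /andP[] := nu01.
exact: cvg0_of_weighted_cvg0 c_gt0 f_ge0 lam_lb lamf0.
Unshelve. all: by end_near. Qed.
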